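(* Let $F$ be a field of characteristic $\neq 2$, let $O$ be a Cayley algebra over $F$, $V=\operatorname{im}(O)$ and $$\mathcal{B}=\{\operatorname{im}(H)\colon H\text{ is a 4-dimensional subalgebra of } O\}.$$ Then $(V,\mathcal{B})$ is a $(7,3,2)$ $q$-covering design (every 2-dimensional subspace of $V$ lies in at least one element of $\mathcal{B}$, and each element of $\mathcal{B}$ is 3-dimensional), it is inclusion-minimal (no proper subcollection of $\mathcal{B}$ covers all 2-dimensional subspaces of $V$), and it is a $2$-$(7,3,1)$ subspace design (every 2-dimensional subspace lies in exactly one element of $\mathcal{B}$) if and only if $O$ is a division algebra.
   Context: All algebras are finite-dimensional unital, not necessarily associative $F$-algebras; subalgebras contain $1$. An involution is a linear map $*$ with $(ab)^*=b^*a^*$, $(a^* )^*=a$. Cayley–Dickson algebras: $F$ (identity involution) is one; if $A$ is one with involution $*$ and $\gamma\in F^\times$, then $D_\gamma(A)=A\oplus A$ with elements written $a+ib$, multiplication $(a+ib)(c+id)=(ac+\gamma db^* )+i(a^*d+cb)$ and involution $(a+ib)^*=a^*-ib$ is one. A Cayley algebra is $D_\gamma(D_\beta(D_\alpha(F)))$ with $\alpha,\beta,\gamma\in F^\times$. $\operatorname{im}(H)=\{a\in H:a^*=-a\}$. A division algebra is one without zero divisors. A $(v,k,t)$ $q$-covering design on a $v$-dimensional space $V$ is a set of $k$-dimensional subspaces of $V$ such that every $t$-dimensional subspace of $V$ is contained in at least one of them. *)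

(* Defs.v *)
From HB Require Import structures.
From mathcomp Require Import all_boot all_order all_algebra.
Set Implicit Arguments. Unset Strict Implicit. Unset Printing Implicit Defensive.
Import GRing.Theory.
Local Open Scope ring_scope.

(* A Cayley-Dickson algebra of dimension d over F, modelled on row vectors
   'rV[F]_d: multiplication, involution (a linear map given by a matrix,
   x |-> x *m cdconj), and unit element. *)
Record CD (F : fieldType) (d : nat) := MkCD {
  cdmul  : 'rV[F]_d -> 'rV[F]_d -> 'rV[F]_d;
  cdconj : 'M[F]_d;
  cdone  : 'rV[F]_d }.

Definition CD_base (F : fieldType) : CD F 1 :=
  @MkCD F 1 (fun x y => scalar_mx (x ord0 ord0 * y ord0 ord0)) (scalar_mx 1) (scalar_mx 1).

(* D_gamma(A) = A (+) A, elements a + i b written as row_mx a b: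
   (a+ib)(c+id) = (ac + gamma d conj(b)) + i(conj(a) d + c b), conj(a+ib) = conj(a) - ib. *)
Definition CD_double (F : fieldType) (d : nat) (A : CD F d) (g : F)
  : CD F (d + d) :=
  let m := cdmul A in
  let cj := fun x : 'rV[F]_d => x *m cdconj A in
  @MkCD F (d + d)
    (fun x y =>
       let a := lsubmx x in let b := rsubmx x in
       let c := lsubmx y in let e := rsubmx y in
       row_mx (m a c + g *: m e (cj b)) (m (cj a) e + m c b))
    (block_mx (cdconj A) 0 0 (scalar_mx (-1)))
    (row_mx (cdone A) 0).

Definition cdim8 : nat := (1 + 1 + (1 + 1)) + (1 + 1 + (1 + 1)).

Definition Cayley (F : fieldType) (al be ga : F) : CD F cdim8 :=
  CD_double (CD_double (CD_double (CD_base F) al) be) ga.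

Section Notions.
Variables (F : fieldType) (d : nat) (A : CD F d).

Definition cd_conj (x : 'rV[F]_d) : 'rV[F]_d := x *m cdconj A.

(* im(A) = { a | a* = -a } = kernel of the linear map x |-> x* + x. *)
Definition cd_im : {vspace 'rV[F]_d} :=
  lker (linfun (fun x : 'rV[F]_d => x *m (cdconj A + scalar_mx 1))).

Definition cd_subalg (H : {vspace 'rV[F]_d}) : Prop :=
  cdone A \in H /\ forall x y, x \in H -> y \in H -> cdmul A x y \in H.

Definition cd_imsub (H : {vspace 'rV[F]_d}) : {vspace 'rV[F]_d} :=
  (H :&: cd_im)%VS.

Definition cd_block (W : {vspace 'rV[F]_d}) : Prop :=
  exists H : {vspace 'rV[F]_d}, [/\ cd_subalg H, \dim H = 4%N & W = cd_imsub H].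

Definition cd_division : Prop :=
  forall x y : 'rV[F]_d, cdmul A x y = 0 -> x = 0 \/ y = 0.
End Notions.

(* Main.v *)
Require Import Defs.
From HB Require Import structures.
From mathcomp Require Import all_boot all_order all_algebra.
From mathcomp Require Import ring.
From Stdlib Require Import Classical_Prop.
Import GRing.Theory.
Local Open Scope ring_scope.

(** Write [<x, y>] for the symmetric form with [<x, x>] the norm of [x], so that
    imaginary [a, b] satisfy [ab + ba = -2<a, b>] and [V] is the orthogonal of
    [1]. By alternativity [<1, a, b, ab>] is a subalgebra, hence it is the only
    4-dimensional subalgebra containing [a, b] as soon as [1, a, b, ab] are
    independent. If they are dependent, then [(a - z)(b - y) = 0] for some scalars
    [y, z], and up to a change of basis of [<a, b>] one is in one of two cases:
    - [ab = 0] with [a, b] singular: then [<1, a, b, e>] is a subalgebra, where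
      [e = ac + 1] for any imaginary [c] with [<a, c> = 1] and [<b, c> = 0];
      it satisfies [e^2 = 1], [ea = -a], [eb = b];
    - [e^2 = 1] and [ex = x]: then [<1, e, x, f>] is a subalgebra, where
      [f = c - ec] is a [-1]-eigenvector of [e] not orthogonal to [x].
    Minimality: in a 4-dimensional subalgebra without independent [1, a, b, ab]
    one finds [e] with [e^2 = 1] and independent [x, y] with [ex = x], [ey = y],
    [xy = 0], which is impossible. Finally, zero divisors yield imaginary
    independent [a, b] with [ab = 0], and then the plane [<e, b>] lies both in
    [<1, e, a, b>], where [b] is orthogonal to everything, and in [<1, e, b, f>]
    with [<b, f> = 1]. *)

(* [form x x] is the norm of [x]; hence [form] is half of the usual polar form. *)
Record composition_form (F : fieldType) (d : nat) (A : CD F d)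
    (form : 'rV[F]_d -> 'rV[F]_d -> F) : Prop := CompositionForm {
  cf_mulDl x y z : cdmul A (x + y) z = cdmul A x z + cdmul A y z;
  cf_mulDr x y z : cdmul A x (y + z) = cdmul A x y + cdmul A x z;
  cf_mulZl s x y : cdmul A (s *: x) y = s *: cdmul A x y;
  cf_mulZr s x y : cdmul A x (s *: y) = s *: cdmul A x y;
  cf_mul1x x : cdmul A (cdone A) x = x;
  cf_mulx1 x : cdmul A x (cdone A) = x;
  cf_formC x y : form x y = form y x;
  cf_formDl x y z : form (x + y) z = form x z + form y z;
  cf_formZl s x y : form (s *: x) y = s * form x y;
  cf_form11 : form (cdone A) (cdone A) = 1;
  cf_imE x : (x \in cd_im A) = (form x (cdone A) == 0);
  cf_sqr_l a x : form a (cdone A) = 0 ->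
    cdmul A a (cdmul A a x) = - form a a *: x;
  cf_sqr_r a x : form a (cdone A) = 0 ->
    cdmul A (cdmul A x a) a = - form a a *: x;
  cf_form_mull a x y : form a (cdone A) = 0 ->
    form (cdmul A a x) y = - form x (cdmul A a y);
  cf_dual (U : {vspace 'rV[F]_d}) x : x \notin U ->
    exists2 c, form x c = 1 & {in U, forall u, form u c = 0} }.

(** * Calculus of products in an algebra with a composition form *)

Section CompositionAlgebra.
Variables (F : fieldType) (d : nat) (A : CD F d).
Variable form : 'rV[F]_d -> 'rV[F]_d -> F.
Hypothesis formA : composition_form F d A form.
Hypothesis two_neq0 : 2%:R != 0 :> F.

Local Notation "x ** y" := (cdmul A x y) (at level 40, left associativity).
Local Notation one := (cdone A).
Local Notation "'[ x , y ]" := (form x y).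
Local Notation im a := ('[a, one] = 0).
Implicit Types (a b c e f x y z : 'rV[F]_d) (X : seq 'rV[F]_d).
Implicit Types (H U W : {vspace 'rV[F]_d}).

Let mulDl := cf_mulDl _ _ _ _ formA.
Let mulDr := cf_mulDr _ _ _ _ formA.
Let mulZl := cf_mulZl _ _ _ _ formA.
Let mulZr := cf_mulZr _ _ _ _ formA.
Let mul1x := cf_mul1x _ _ _ _ formA.
Let mulx1 := cf_mulx1 _ _ _ _ formA.
Let formC := cf_formC _ _ _ _ formA.
Let formDl := cf_formDl _ _ _ _ formA.
Let formZl := cf_formZl _ _ _ _ formA.
Let form11 := cf_form11 _ _ _ _ formA.
Let imE := cf_imE _ _ _ _ formA.
Let sqr_l := cf_sqr_l _ _ _ _ formA.
Let sqr_r := cf_sqr_r _ _ _ _ formA.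
Let form_mull := cf_form_mull _ _ _ _ formA.
Let dual := cf_dual _ _ _ _ formA.

Lemma cf_mul0x x : 0 ** x = 0.
Proof. by rewrite -(scale0r 0) mulZl !scale0r. Qed.

Lemma cf_mulx0 x : x ** 0 = 0.
Proof. by rewrite -(scale0r 0) mulZr !scale0r. Qed.

Lemma cf_mulNl x y : (- x) ** y = - (x ** y).
Proof. by rewrite -scaleN1r mulZl scaleN1r. Qed.

Lemma cf_mulNr x y : x ** (- y) = - (x ** y).
Proof. by rewrite -scaleN1r mulZr scaleN1r. Qed.

Lemma cf_formNl x y : '[- x, y] = - '[x, y].
Proof. by rewrite -scaleN1r formZl mulN1r. Qed.

Lemma cf_form0l x : '[0, x] = 0.
Proof. by rewrite -(scale0r 0) formZl mul0r. Qed.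

Lemma cf_formDr x y z : '[z, x + y] = '[z, x] + '[z, y].
Proof. by rewrite !(formC z) formDl. Qed.

Lemma cf_formZr s x y : '[x, s *: y] = s * '[x, y].
Proof. by rewrite !(formC x) formZl. Qed.

Lemma cf_formNr x y : '[x, - y] = - '[x, y].
Proof. by rewrite !(formC x) cf_formNl. Qed.

Lemma cf_form0r x : '[x, 0] = 0.
Proof. by rewrite formC cf_form0l. Qed.

Let mulE := (mulDl, mulDr, mulZl, mulZr, cf_mulNl, cf_mulNr, cf_mul0x,
  cf_mulx0, mul1x, mulx1).

Let formE := (formDl, cf_formDr, formZl, cf_formZr, cf_formNl, cf_formNr,
  cf_form0l, cf_form0r, form11).

(** Polarization: expand [sqr_l] at [a + b] and cancel the two square terms. *)
Lemma cf_anti_l a b z : im a -> im b ->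
  a ** (b ** z) + b ** (a ** z) = - (2%:R * '[a, b]) *: z.
Proof.
move=> a0 b0; have := sqr_l (a + b) z.
rewrite !mulE !formE a0 b0 addr0 !sqr_l // (formC b a) => /(_ erefl) eq.
have -> : a ** (b ** z) + b ** (a ** z) =
  - '[a, a] *: z + a ** (b ** z) + (b ** (a ** z) - '[b, b] *: z)
  + ('[a, a] + '[b, b]) *: z by apply/rowP => i; rewrite !mxE; ring.
by rewrite -scaleNr -addrA in eq *; rewrite eq -scalerDl; congr (_ *: _); ring.
Qed.

Lemma cf_anti_r a b z : im a -> im b ->
  (z ** a) ** b + (z ** b) ** a = - (2%:R * '[a, b]) *: z.
Proof.
move=> a0 b0; have := sqr_r (a + b) z.
rewrite !mulE !formE a0 b0 addr0 !sqr_r // (formC b a) => /(_ erefl) eq.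
have -> : (z ** a) ** b + (z ** b) ** a =
  - '[a, a] *: z + (z ** b) ** a + ((z ** a) ** b - '[b, b] *: z)
  + ('[a, a] + '[b, b]) *: z by apply/rowP => i; rewrite !mxE; ring.
by rewrite -scaleNr -addrA in eq *; rewrite eq -scalerDl; congr (_ *: _); ring.
Qed.

(** With this linear structure [lfunE] applies to [linfun (cdmul A x)], whose kernel is used for
    zero divisors. *)
HB.instance Definition _ x :=
  GRing.isLinear.Build F 'rV[F]_d 'rV[F]_d *:%R (cdmul A x)
    (fun s u v => etrans (mulDr _ _ _) (congr1 (+%R^~ _) (mulZr _ _ _))).

Lemma cf_sqr a : im a -> a ** a = - '[a, a] *: one.
Proof. by move=> a0; rewrite -{2}[a]mulx1 sqr_l. Qed.

Lemma cf_mul_swap a b : im a -> im b ->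
  b ** a = - (a ** b) - (2%:R * '[a, b]) *: one.
Proof.
move=> a0 b0; have := cf_anti_l a b one a0 b0.
by rewrite !mulx1 scaleNr => <-; rewrite addKr.
Qed.

Lemma cf_form_mul1 a b : im a -> '[a ** b, one] = - '[a, b].
Proof. by move=> a0; rewrite form_mull // mulx1 formC. Qed.

(** * Spans, four-dimensional subalgebras and independence *)

Lemma span_consP (u v : 'rV[F]_d) X : v \in <<u :: X>>%VS ->
  exists s, exists2 w, w \in <<X>>%VS & v = s *: u + w.
Proof.
by rewrite span_cons => /memv_addP[_ /vlineP[s ->] [w wX ->]]; exists s, w.
Qed.

Lemma span_ind (P : 'rV[F]_d -> Prop) X : P 0 ->
  (forall s u v, P u -> P v -> P (s *: u + v)) ->
  {in X, forall x, P x} -> {in <<X>>%VS, forall x, P x}.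
Proof.
move=> P0 PL; elim: X => [|u X IH] PX x.
  by rewrite span_nil memv0 => /eqP->.
case/span_consP => s [w wX ->]; apply: PL; first by apply: PX; rewrite mem_head.
by apply: IH wX => y yX; apply: PX; rewrite inE yX orbT.
Qed.

Lemma form_span0 c X : {in X, forall x, '[x, c] = 0} ->
  {in <<X>>%VS, forall x, '[x, c] = 0}.
Proof.
apply: span_ind => [|s u v u0 v0]; first exact: cf_form0l.
by rewrite !formE u0 v0 mulr0 addr0.
Qed.

Lemma span_mul_closed X :
  (forall x y, x \in X -> y \in X -> x ** y \in <<X>>%VS) ->
  forall x y, x \in <<X>>%VS -> y \in <<X>>%VS -> x ** y \in <<X>>%VS.
Proof.
move=> mulX x y xX yX; move: x xX; apply: span_ind => [|s u v uX vX|x xX].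
- by rewrite cf_mul0x mem0v.
- by rewrite !mulE memvD ?memvZ.
move: y yX; apply: span_ind => [|s u v uX vX|y yX]; last exact: mulX.
- by rewrite cf_mulx0 mem0v.
- by rewrite !mulE memvD ?memvZ.
Qed.

(** Imaginary elements have scalar squares and anticommute up to scalars, so three products suffice.
    The vector [c] stands first because freeness is later proved by adjoining it to [one], [a],
    [b]. *)
Lemma subalg4 a b c (H := <<[:: c; one; a; b]>>%VS) : im a -> im b -> im c ->
  a ** b \in H -> a ** c \in H -> b ** c \in H -> cd_subalg A H.
Proof.
move=> a0 b0 c0 abH acH bcH.
have mem x : x \in [:: c; one; a; b] -> x \in H by apply: memv_span.
have oneH : one \in H by apply: mem; rewrite !inE eqxx ?orbT.
have aH : a \in H by apply: mem; rewrite !inE eqxx ?orbT.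
have bH : b \in H by apply: mem; rewrite !inE eqxx ?orbT.
have cH : c \in H by apply: mem; rewrite !inE eqxx ?orbT.
have sq x : im x -> x ** x \in H by move=> /cf_sqr->; rewrite memvZ.
have sw x y : im x -> im y -> x ** y \in H -> y ** x \in H.
  by move=> x0 y0 xyH; rewrite cf_mul_swap // memvB ?memvN ?memvZ.
split=> //; apply: span_mul_closed => x y.
by rewrite !inE => /or4P[]/eqP-> /or4P[]/eqP->; rewrite ?mul1x ?mulx1 //; auto.
Qed.

Lemma span3P (v u1 u2 u3 : 'rV[F]_d) : v \in <<[:: u1; u2; u3]>>%VS ->
  exists r s t, v = r *: u1 + s *: u2 + t *: u3.
Proof.
case/span_consP => r [v1 /span_consP[s [v2 /span_consP[t [v3]]]]].
by rewrite span_nil memv0 => /eqP-> -> -> ->; exists r, s, t; rewrite addr0 addrA.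
Qed.

Lemma notin_span c u X : {in X, forall x, '[x, c] = 0} -> '[u, c] != 0 ->
  u \notin <<X>>%VS.
Proof. by move=> cX; apply: contra => uX; rewrite (form_span0 c X). Qed.

Lemma free_one_cons X : {in X, forall x, im x} -> free X -> free (one :: X).
Proof.
by move=> X0 fX; rewrite free_cons fX andbT (notin_span one) // form11 oner_eq0.
Qed.

Lemma free2_coef a b s t : free [:: a; b] -> s *: a + t *: b = 0 ->
  s = 0 /\ t = 0.
Proof.
rewrite free_cons seq1_free span_seq1 => /andP[aNb b0] eq.
have s0 : s = 0.
  apply/eqP/negPn/negP => s_neq0; case/negP: aNb; apply/vlineP.
  exists (- (s^-1 * t)); rewrite -[a](scalerK s_neq0) -[s *: a](addrK (t *: b)) eq.
  by rewrite sub0r scalerN scalerA scaleNr.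
split=> //; move: eq; rewrite s0 scale0r add0r => /eqP.
by rewrite scaler_eq0 (negPf b0) orbF => /eqP.
Qed.

Lemma free3_coef a b r s t : im a -> im b -> free [:: a; b] ->
  r *: one + s *: a + t *: b = 0 -> [/\ r = 0, s = 0 & t = 0].
Proof.
move=> a0 b0 fab eq; have r0 : r = 0.
  have := congr1 (form^~ one) eq; rewrite !formE a0 b0 => <-; ring.
have [|-> ->] // := free2_coef a b s t fab.
by rewrite -eq r0 scale0r add0r.
Qed.

(* If [ab] is in [<1, a, b>], then [(a - z)(b - y)] is a scalar for some [y, z];
   it is [0] since otherwise [b] would be in [<1, a>]. *)
Lemma dependent_mul a b : im a -> im b -> free [:: a; b] ->
  a ** b \in <<[:: one; a; b]>>%VS ->
  exists y z : F, [/\ '[a, a] = - z ^+ 2, '[b, b] = - y ^+ 2, '[a, b] = y * z,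
    a ** b = - (y * z) *: one + y *: a + z *: b &
    (a - z *: one) ** (b - y *: one) = 0].
Proof.
move=> a0 b0 fab /span3P[x [y [z abE]]]; exists y, z.
(* With [ab = x + ya + zb], these are the coefficients of [a(ab) + <a, a>b = 0]. *)
have [|_ eqx eqz] := free3_coef a b (z * x - y * '[a, a]) (x + z * y)
  (z ^+ 2 + '[a, a]) a0 b0 fab.
  have := sqr_l a b a0; rewrite {1}abE !mulE cf_sqr // abE => /eqP.
  rewrite -subr_eq0 => /eqP <-; apply/rowP => i; rewrite !mxE; ring.
have {}eqx : x = - (y * z) by rewrite -[x](addrK (z * y)) eqx; ring.
have {}eqz : '[a, a] = - z ^+ 2 by rewrite -[LHS](addKr (z ^+ 2)) eqz addr0.
(* Likewise for [(ab)b + <b, b>a = 0]. *)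
have [|_ eqy _] := free3_coef a b (y * x - z * '[b, b]) (y ^+ 2 + '[b, b])
  (x + y * z) a0 b0 fab.
  have := sqr_r b a b0; rewrite {1}abE !mulE (cf_sqr b) // abE => /eqP.
  rewrite -subr_eq0 => /eqP <-; apply/rowP => i; rewrite !mxE; ring.
split=> //.
- by rewrite -[LHS](addKr (y ^+ 2)) eqy addr0.
- by rewrite -[LHS]opprK -cf_form_mul1 // abE !formE a0 b0 eqx; ring.
- by rewrite abE eqx.
by rewrite !mulE abE eqx; apply/rowP => i; rewrite !mxE; ring.
Qed.

(** * Imaginary [e] with [e^2 = 1], that is [<e, e> = -1], and their eigenvectors *)

Lemma null_involution a c (e := a ** c + one) : im a -> im c ->
  '[a, a] = 0 -> '[a, c] = 1 ->
  [/\ im e, '[e, e] = -1, e ** a = - a &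
      forall b, im b -> a ** b = 0 -> '[b, c] = 0 -> e ** b = b].
Proof.
move=> a0 c0 aa ac.
(* Both eigenvalue claims are instances of this: [(ac)b = -(ab)c - 2<b, c>a] by right
   anticommutation, taken at [b = a] and at [b] with [ab = 0], [<b, c> = 0]. *)
have eb b : im b -> e ** b = - ((a ** b) ** c) - (2%:R * '[b, c]) *: a + b.
  move=> b0; rewrite /e !mulE; congr (_ + b).
  have := cf_anti_r b c a b0 c0; rewrite scaleNr => <-.
  by rewrite addKr.
split=> [|||b b0 ab bc].
- by rewrite !formE cf_form_mul1 // ac addNr.
- rewrite !formE (formC one) !cf_form_mul1 // form_mull // sqr_l // aa.
  by rewrite oppr0 scale0r !formE ac; ring.
- rewrite eb // cf_sqr // aa ac oppr0 scale0r cf_mul0x.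
  by apply/rowP => i; rewrite !mxE; ring.
- by rewrite eb // ab bc cf_mul0x mulr0 scale0r !oppr0 !add0r.
Qed.

(** First, [<e, x> = -<ex, 1> = -<x, 1>]. Second, left multiplication by [e] is skew-adjoint, so
    [<x, x> = -<x, x>]. *)
Lemma eigen_form e x : im e -> im x -> e ** x = x ->
  '[e, x] = 0 /\ '[x, x] = 0.
Proof.
move=> e0 x0 ex; split; first by rewrite -[LHS]opprK -cf_form_mul1 // ex x0 oppr0.
have /eqP := form_mull e x x e0; rewrite ex -subr_eq0 opprK -mulr2n -mulr_natl.
by rewrite mulf_eq0 (negPf two_neq0) => /eqP.
Qed.

(** Take [c] dual to [x] and orthogonal to [1], [e], [y], and project it to the [-1]-eigenspace of
    [e]. This keeps the pairings with [x] and [y], since both are fixed by [e]. *)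
Lemma eigen_dual e x y : im e -> '[e, e] = -1 -> im x -> im y ->
  e ** x = x -> e ** y = y -> x \notin <[y]>%VS ->
  exists f, [/\ im f, e ** f = - f, '[x, f] = 1, '[y, f] = 0 &
                x ** f = - one - e].
Proof.
move=> e0 ee x0 y0 ex ey xNy.
have [ex0 xx] := eigen_form e x e0 x0 ex; have [ey0 yy] := eigen_form e y e0 y0 ey.
have [|c xc cU] := dual <<[:: one; e; y]>>%VS x.
  apply: contra xNy => /span3P[r [s [t xE]]].
  have r0 : r = 0.
    by have := congr1 (form^~ one) xE; rewrite x0 !formE e0 y0 => ->; ring.
  have s0 : s = 0.
    have := congr1 (form^~ e) xE; rewrite !formE (formC x) (formC y) ex0 ey0 ee.
    rewrite r0 => s0; apply: oppr_inj; rewrite oppr0 s0; ring.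
  by rewrite xE r0 s0 !scale0r !add0r memvZ ?memv_line.
have cmem u : u \in [:: one; e; y] -> '[u, c] = 0.
  by move=> uX; apply: cU; apply: memv_span.
have onec : '[one, c] = 0 by apply: cmem; rewrite !inE eqxx ?orbT.
have ec : '[e, c] = 0 by apply: cmem; rewrite !inE eqxx ?orbT.
have yc : '[y, c] = 0 by apply: cmem; rewrite !inE eqxx ?orbT.
(* As [e(ec) = c], the map [(1 - e)/2] is the projection to the [-1]-eigenspace. *)
pose f := 2%:R^-1 *: (c - e ** c).
have f0 : im f by rewrite !formE cf_form_mul1 // ec (formC c) onec; ring.
have ef : e ** f = - f.
  by rewrite /f !mulE sqr_l // ee; apply/rowP => i; rewrite !mxE; ring.
have formf z : '[z, f] = 2%:R^-1 * ('[z, c] + '[e ** z, c]).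
  by rewrite !formE form_mull.
clearbody f.
have xf : '[x, f] = 1 by rewrite formf ex xc; field.
have yf : '[y, f] = 0 by rewrite formf ey yc; ring.
have fe : '[f, e] = 0.
  by rewrite formC -[LHS]opprK -cf_form_mul1 // ef cf_formNl f0 !oppr0.
exists f; split=> //.
have eg : e ** (x ** f) = x ** f.
  have := cf_anti_l e x f e0 x0; rewrite ex0 mulr0 oppr0 scale0r ef !mulE.
  by move/eqP; rewrite subr_eq0 => /eqP.
have xe : x ** e = - x by rewrite cf_mul_swap // ex ex0 mulr0 scale0r subr0.
have ge : (x ** f) ** e = x ** f.
  have := cf_anti_r f e x f0 e0; rewrite fe mulr0 oppr0 scale0r xe !mulE.
  by move/eqP; rewrite subr_eq0 => /eqP.
(* The imaginary element [xf + 1] commutes with [e], so [cf_mul_swap] makes [e(xf + 1) = xf + e] the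
   scalar [-k]; pairing with [1] gives [k = 1]. *)
pose k := '[e, x ** f + one].
have g0 : im (x ** f + one) by rewrite !formE cf_form_mul1 // xf addNr.
have : x ** f + e = - k *: one.
  apply: (scalerI two_neq0); have := cf_mul_swap e _ e0 g0.
  rewrite !mulE eg ge => /eqP; rewrite -subr_eq0 => /eqP eq0.
  rewrite -[LHS]subr0 -{1}eq0 -/k; apply/rowP => i; rewrite !mxE; ring.
move=> gE; have := congr1 (form^~ one) gE; rewrite !formE cf_form_mul1 // xf e0.
rewrite addr0 mulr1 => kE; rewrite -kE in gE.
by rewrite -[LHS](addrK e) gE scaleN1r.
Qed.

(** With [f] from [eigen_dual], [(xf)y + (xy)f = -2<f, y>x = 0] reads [-(1 + e)y = 0], that is
    [-2y = 0]. This is the contradiction behind minimality. *)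
Lemma eigen_mul_neq0 e x y : im e -> '[e, e] = -1 -> im x -> im y ->
  e ** x = x -> e ** y = y -> x ** y = 0 -> x \in <[y]>%VS \/ y = 0.
Proof.
move=> e0 ee x0 y0 ex ey xy.
have [|xNy] := boolP (x \in <[y]>%VS); [by left | right].
have [f [f0 _ _ yf xf]] := eigen_dual e x y e0 ee x0 y0 ex ey xNy.
have := cf_anti_r f y x f0 y0.
rewrite (formC f) yf mulr0 oppr0 scale0r xy xf !mulE ey addr0 => /eqP.
rewrite -opprD oppr_eq0 -mulr2n -scaler_nat scaler_eq0 (negPf two_neq0).
by move/eqP.
Qed.

(** * Four-dimensional subalgebras through a given pair *)

Lemma mem_im a : a \in cd_im A -> im a.
Proof. by rewrite imE => /eqP. Qed.

Lemma null_pair_subalg a b : im a -> im b -> free [:: a; b] -> a ** b = 0 ->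
  '[a, a] = 0 ->
  exists e, [/\ im e, '[e, e] = -1, e ** b = b,
    cd_subalg A <<[:: e; one; a; b]>> & free [:: e; one; a; b]].
Proof.
move=> a0 b0 fab ab aa.
have [|c ac cU] := dual <<[:: one; b]>>%VS a.
  rewrite span_cons; apply/negP => /memv_addP[_ /vlineP[r ->] [w]].
  rewrite span_seq1 => /vlineP[s ->] aE.
  have [|_ /eqP + _] := free3_coef a b r (- 1) s a0 b0 fab.
    by rewrite scaleN1r addrAC -aE subrr.
  by rewrite oppr_eq0 oner_eq0.
have c0 : im c by rewrite formC cU // memv_span // !inE eqxx.
have bc : '[b, c] = 0 by rewrite cU // memv_span // !inE eqxx orbT.
have [e0 ee ea eb] := null_involution a c a0 c0 aa ac.
set e := a ** c + one in e0 ee ea eb; clearbody e; exists e.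
have {}eb := eb b b0 ab bc.
have ea0 : '[e, a] = 0 by rewrite -[LHS]opprK -cf_form_mul1 // ea !formE a0 !oppr0.
have [eb0 _] := eigen_form e b e0 b0 eb.
split=> //.
  apply: subalg4 => //; first by rewrite ab mem0v.
    rewrite cf_mul_swap // ea ea0 mulr0 scale0r subr0 opprK.
    by rewrite memv_span ?inE ?eqxx ?orbT.
  rewrite cf_mul_swap // eb eb0 mulr0 scale0r subr0 memvN.
  by rewrite memv_span ?inE ?eqxx ?orbT.
(* [e] is orthogonal to [1], [a], [b] but not to itself. *)
rewrite free_cons (notin_span e) ?ee ?oppr_eq0 ?oner_eq0 //=.
  by apply: free_one_cons => // x; rewrite !inE => /orP[]/eqP->.
by move=> x; rewrite !inE => /or3P[]/eqP->; rewrite formC.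
Qed.

Lemma eigen_subalg e x : im e -> '[e, e] = -1 -> im x -> e ** x = x -> x != 0 ->
  exists f, [/\ im f, '[x, f] = 1, cd_subalg A <<[:: f; one; e; x]>> &
                free [:: f; one; e; x]].
Proof.
move=> e0 ee x0 ex xn0.
(* For [y = 0] the independence condition reduces to [x != 0]. *)
have [|||f [f0 ef xf _ xfE]] := eigen_dual e x 0 e0 ee x0 _ ex _ _.
- exact: cf_form0l.
- exact: cf_mulx0.
- by apply: contra xn0 => /vlineP[k ->]; rewrite scaler0.
have [ex0 xx] := eigen_form e x e0 x0 ex.
have fe : '[e, f] = 0 by rewrite -[LHS]opprK -cf_form_mul1 // ef !formE f0 !oppr0.
exists f; split=> //.
  apply: subalg4 => //.
  - by rewrite ex memv_span ?inE ?eqxx ?orbT.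
  - by rewrite ef memvN memv_span ?inE ?eqxx ?orbT.
  - by rewrite xfE memvB ?memvN ?memv_span ?inE ?eqxx ?orbT.
rewrite free_cons (notin_span x) ?(formC f) ?xf ?oner_eq0 //=; last first.
  by move=> y; rewrite !inE => /or3P[]/eqP->; rewrite // formC.
apply: free_one_cons => [y|]; first by rewrite !inE => /orP[]/eqP->.
rewrite free_cons seq1_free xn0 andbT (notin_span e) ?ee ?oppr_eq0 ?oner_eq0 //.
by move=> y; rewrite !inE => /eqP->; rewrite formC.
Qed.

Lemma dim_span_free X : free X -> \dim <<X>> = size X.
Proof. exact: eqP. Qed.

Lemma pair_subalg a b : im a -> im b -> free [:: a; b] ->
  exists H, [/\ cd_subalg A H, \dim H = 4%N, a \in H & b \in H].
Proof.
move=> a0 b0 fab.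
have [abU|abNU] := boolP (a ** b \in <<[:: one; a; b]>>%VS); last first.
  (* The imaginary part of [ab], since [<ab, 1> = -<a, b>]. *)
  pose c := '[a, b] *: one + a ** b.
  have c0 : im c by rewrite !formE cf_form_mul1 // mulr1 subrr.
  have cNU : c \notin <<[:: one; a; b]>>%VS.
    apply: contra abNU => cU; rewrite -[a ** b](addKr ('[a, b] *: one)) -/c.
    by rewrite memvD // memvN memvZ // memv_span // mem_head.
  have fc : free [:: c; one; a; b].
    rewrite free_cons cNU; apply: free_one_cons => // x.
    by rewrite !inE => /orP[]/eqP->.
  exists <<[:: c; one; a; b]>>%VS; split; last 2 first.
  - by rewrite memv_span ?inE ?eqxx ?orbT.
  - by rewrite memv_span ?inE ?eqxx ?orbT.
  - apply: subalg4 => //.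
    + have -> : a ** b = c - '[a, b] *: one by rewrite /c addrC addKr.
      by rewrite memvB ?memvZ ?memv_span ?inE ?eqxx ?orbT.
    + by rewrite /c !mulE sqr_l // memvD ?memvZ ?memv_span ?inE ?eqxx ?orbT.
    + have -> : b ** c = '[b, b] *: a - '[a, b] *: b.
        rewrite /c !mulE -[b ** (a ** b)](addKr (a ** (b ** b))) cf_anti_l //.
        by rewrite (cf_sqr b) // !mulE; apply/rowP => i; rewrite !mxE; ring.
      by rewrite memvB ?memvZ ?memv_span ?inE ?eqxx ?orbT.
  - exact: dim_span_free.
have [y [z [aa bb abf abE _]]] := dependent_mul a b a0 b0 fab abU.
(* If [z != 0], then [e = a/z] and [x = ya + zb] span the same plane and satisfy [e^2 = 1],
   [ex = x]. *)
have main a' b' (y' z' : F) : im a' -> im b' -> free [:: a'; b'] -> z' != 0 ->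
    '[a', a'] = - z' ^+ 2 -> a' ** b' = - (y' * z') *: one + y' *: a' + z' *: b' ->
    exists H, [/\ cd_subalg A H, \dim H = 4%N, a' \in H & b' \in H].
  move=> {}a0 {}b0 {}fab z0 {}aa {}abE.
  pose e := z'^-1 *: a'; pose x := y' *: a' + z' *: b'.
  have e0 : im e by rewrite !formE a0 mulr0.
  have x0 : im x by rewrite !formE a0 b0; ring.
  have ee : '[e, e] = -1 by rewrite !formE aa; field.
  have ex : e ** x = x.
    rewrite /x /e !mulE cf_sqr // aa abE; apply/rowP => i; rewrite !mxE; field.
    exact: z0.
  have xn0 : x != 0.
    by apply: contraNneq z0 => /(free2_coef a' b' _ _ fab)[_ ->].
  have [f [f0 _ sH fH]] := eigen_subalg e x e0 ee x0 ex xn0.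
  have eH : e \in <<[:: f; one; e; x]>>%VS by rewrite memv_span ?inE ?eqxx ?orbT.
  have xH : x \in <<[:: f; one; e; x]>>%VS by rewrite memv_span ?inE ?eqxx ?orbT.
  have aH : a' \in <<[:: f; one; e; x]>>%VS.
    by rewrite -[a'](scalerKV z0) memvZ.
  exists <<[:: f; one; e; x]>>%VS; split=> //; first exact: dim_span_free.
  rewrite -[b'](scalerK z0) memvZ // -[_ *: b'](addKr (y' *: a')) -/x.
  by rewrite memvD ?memvN ?memvZ.
have [z0|z0] := eqVneq z 0; last exact: main z0 aa abE.
have [y0|y0] := eqVneq y 0.
  have ab : a ** b = 0 by rewrite abE z0 y0 mulr0 oppr0 !scale0r !addr0.
  have {}aa : '[a, a] = 0 by rewrite aa z0 expr2 mulr0 oppr0.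
  have [e [_ _ _ sH fH]] := null_pair_subalg a b a0 b0 fab ab aa.
  exists <<[:: e; one; a; b]>>%VS; split=> //; first exact: dim_span_free.
  - by rewrite memv_span ?inE ?eqxx ?orbT.
  - by rewrite memv_span ?inE ?eqxx ?orbT.
(* Now [z = 0] and [y != 0]: exchange [a] and [b]. As [<a, b> = yz], one gets [ba = -yz - zb - ya],
   so the coefficients become [-z] and [-y]. *)
have fba : free [:: b; a].
  by rewrite (perm_free (Y := [:: a; b])) // (perm_catC [:: b] [:: a]).
have [|||H [sH dH bH aH]] := main b a (- z) (- y) b0 a0 fba.
- by rewrite oppr_eq0.
- by rewrite sqrrN.
- rewrite cf_mul_swap // abE abf; apply/rowP => i; rewrite !mxE; ring.
by exists H.
Qed.

(** * Generation of four-dimensional subalgebras by pairs *)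

Lemma subalg_generated a b H H' : cd_subalg A H -> cd_subalg A H' ->
  \dim H = 4%N -> \dim H' = 4%N -> a \in H -> b \in H -> a \in H' -> b \in H' ->
  free [:: a ** b; one; a; b] -> H = H'.
Proof.
move=> [oH mH] [oH' mH'] dH dH' aH bH aH' bH' /dim_span_free dX.
have sub (K : {vspace 'rV[F]_d}) :
    one \in K -> (forall x y, x \in K -> y \in K -> x ** y \in K) ->
    \dim K = 4%N -> a \in K -> b \in K -> <<[:: a ** b; one; a; b]>>%VS = K.
  move=> oK mK dK aK bK; apply/eqP; rewrite eqEdim dX dK leqnn andbT.
  by apply/span_subvP => x; rewrite !inE => /or4P[]/eqP->; auto.
by rewrite -(sub H) // -(sub H').
Qed.

Lemma dim_imsub H : one \in H -> (\dim (cd_imsub A H)).+1 = \dim H.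
Proof.
move=> oH; have one0 : one != 0.
  by apply/eqP => one0; have /eqP := form11; rewrite one0 cf_form0l eq_sym oner_eq0.
have HE : H = (<[one]> + cd_imsub A H)%VS.
  apply/eqP; rewrite eqEsubv subv_add -memvE oH capvSl /= andbT.
  apply/subvP => x xH; rewrite -[x](subrK ('[x, one] *: one)) addrC.
  rewrite memv_add ?memvZ ?memv_line // memv_cap memvB ?memvZ //= imE.
  by rewrite !formE mulr1 subrr.
rewrite [in RHS]HE dimv_disjoint_sum ?dim_vline ?one0 ?add1n //.
apply/eqP; rewrite -subv0; apply/subvP => x /memv_capP[/vlineP[k ->]].
rewrite memv_cap => /andP[_ /mem_im]; rewrite !formE mulr1 => ->.
by rewrite scale0r mem0v.
Qed.

Lemma dim2_basis U : \dim U = 2%N ->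
  exists a b, [/\ free [:: a; b], a \in U, b \in U & U = <<[:: a; b]>>%VS].
Proof.
move=> dU; have bU := vbasisP U; move: (vbasis U) bU; rewrite dU => t.
case/tupleP: t => a t; case/tupleP: t => b t; rewrite (tuple0 t) => bU.
exists a, b; rewrite (basis_free bU) -(span_basis bU).
by split=> //; apply: memv_span; rewrite !inE eqxx ?orbT.
Qed.

Lemma dim_lt_ex U W : (\dim U < \dim W)%N -> exists2 w, w \in W & w \notin U.
Proof.
move=> ltUW; apply/subvPn; apply: contraL ltUW => /dimvS.
by rewrite -leqNgt.
Qed.

(** Otherwise [dependent_mul] applies to every independent pair in [W]. This gives a basis [x'],
    [x], [w] of [W] with [x'x = 0] on which [w] acts on [<x', x>] by one scalar, and from [w] an [e]
    that [eigen_mul_neq0] forbids. *)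
Lemma subalg_generators H : cd_subalg A H -> \dim H = 4%N ->
  exists a b, [/\ a \in cd_imsub A H, b \in cd_imsub A H &
                  free [:: a ** b; one; a; b]].
Proof.
move=> [oH mH] dH; set W := cd_imsub A H.
have dW : \dim W = 3%N by apply: succn_inj; rewrite dim_imsub.
have Wim x : x \in W -> im x by rewrite memv_cap => /andP[_ /mem_im].
apply: NNPP => noab.
have dep a b : a \in W -> b \in W -> free [:: a; b] ->
    a ** b \in <<[:: one; a; b]>>%VS.
  move=> aW bW fab; apply: contraT => abN; case: noab; exists a, b; split=> //.
  rewrite free_cons abN; apply: free_one_cons => // x.
  by rewrite !inE => /orP[]/eqP->; apply: Wim.
(* The norm of [ya + zb] is [-y^2z^2 + 2(yz)^2 - z^2y^2 = 0]; if this vector vanishes then [z = 0],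
   and [a] itself is singular. *)
have singular U : (U <= W)%VS -> \dim U = 2%N ->
    exists x, [/\ x \in U, x != 0 & '[x, x] = 0].
  move=> /subvP UW /dim2_basis[a [b [fab aU bU _]]].
  have [a0 b0] := (Wim a (UW a aU), Wim b (UW b bU)).
  have [y [z [aa bb ab _ _]]] := dependent_mul a b a0 b0 fab
    (dep a b (UW a aU) (UW b bU) fab).
  have [yz0|yz0] := eqVneq (y *: a + z *: b) 0.
    have [_ z0] := free2_coef a b y z fab yz0.
    exists a; split=> //; last by rewrite aa z0 expr2 mulr0 oppr0.
    by apply: contraTneq fab => ->; rewrite free_cons mem0v.
  exists (y *: a + z *: b); split; rewrite ?memvD ?memvZ //.
  by rewrite !formE aa bb (formC b) ab; ring.
have diff w : w \in W -> w != 0 -> \dim (W :\: <[w]>) = 2%N.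
  move=> wW w0; apply/eqP; rewrite -(eqn_add2l 1) -[2%N]/(3 - 1)%N.
  have := dimv_cap_compl W <[w]>; rewrite dW (capv_idPr _) -?memvE // dim_vline w0.
  by move->.
have W0 : W != 0%VS by rewrite -dimv_eq0 dW.
(* Any plane of [W] yields [x]; a plane complementary to [<x>] then yields an independent singular
   [x']. *)
have [|x [xW x0 xx]] := singular (W :\: <[vpick W]>)%VS (diffvSl _ _).
  by rewrite diff ?memv_pick ?vpick0.
have {}xW : x \in W by apply: subvP xW; apply: diffvSl.
have [|x' [x'W x'0 xx']] := singular (W :\: <[x]>)%VS (diffvSl _ _).
  by rewrite diff.
have x'Nx : x' \notin <[x]>%VS.
  apply: contra x'0 => x'x; rewrite -memv0 -(capv_diff W <[x]>) memv_cap.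
  by rewrite x'W.
have {}x'W : x' \in W by apply: subvP x'W; apply: diffvSl.
have fx'x : free [:: x'; x] by rewrite free_cons span_seq1 x'Nx seq1_free.
have [|w wW wN] := dim_lt_ex <<[:: x'; x]>>%VS W.
  by rewrite dim_span_free // dW.
have w0 : w != 0 by apply: contraNneq wN => ->; rewrite mem0v.
have [[ix ix'] iw] := (Wim x xW, Wim x' x'W, Wim w wW).
(* For singular [u] the coefficient [y] of [w] in [wu] is zero, so [u] is an eigenvector of [w]. *)
have sing u : u \in <<[:: x'; x]>>%VS -> u != 0 -> u \in W -> '[u, u] = 0 ->
    exists2 z : F, '[w, w] = - z ^+ 2 & w ** u = z *: u.
  move=> uX u0 uW uu.
  have fwu : free [:: w; u].
    rewrite free_cons seq1_free u0 span_seq1 andbT; apply: contra wN.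
    by case/vlineP => k ->; rewrite memvZ.
  have [y [z [ww]]] := dependent_mul w u iw (Wim u uW) fwu (dep w u wW uW fwu).
  rewrite uu => /esym/eqP; rewrite oppr_eq0 expf_eq0 /= => /eqP-> _ wuE _.
  by exists z; rewrite // wuE mul0r oppr0 !scale0r !add0r.
have x'x : x' ** x = 0 /\ '[x', x] = 0.
  have [y [z []]] := dependent_mul x' x ix' ix fx'x (dep x' x x'W xW fx'x).
  rewrite xx xx' => /esym/eqP; rewrite oppr_eq0 expf_eq0 /= => /eqP->.
  move=> /esym/eqP; rewrite oppr_eq0 expf_eq0 /= => /eqP-> -> -> _.
  by rewrite mulr0 oppr0 !scale0r !addr0.
have [x'x0 fx'x0] := x'x.
have memx : x \in <<[:: x'; x]>>%VS by rewrite memv_span ?inE ?eqxx ?orbT.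
have memx' : x' \in <<[:: x'; x]>>%VS by rewrite memv_span ?inE ?eqxx ?orbT.
have noeig e : im e -> '[e, e] = -1 -> e ** x = x -> e ** x' = x' -> False.
  move=> e0 ee ex ex'.
  case: (eigen_mul_neq0 e x' x e0 ee ix' ix ex' ex x'x0) => [x'x1|/eqP].
    by rewrite x'x1 in x'Nx.
  by rewrite (negPf x0).
have [z ww wx] := sing x memx x0 xW xx.
have [z' _ wx'] := sing x' memx' x'0 x'W xx'.
(* As [x' + x] is an eigenvector too, the eigenvalues on [x'] and [x] agree. *)
have [||||z'' _] := sing (x' + x).
- by rewrite memvD.
- apply: contra x'Nx; rewrite addr_eq0 => /eqP->; by rewrite memvN memv_line.
- by rewrite memvD.
- by rewrite !formE xx xx' (formC x) fx'x0 !addr0.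
rewrite mulDr wx wx' => eqz.
have [|z'E zE] := free2_coef x' x (z' - z'') (z - z'') fx'x.
  by rewrite !scalerBl addrACA eqz scalerDr -opprD subrr.
have {}z'E : z' = z by rewrite -(subrK z'' z') z'E -zE subrK.
(* For [z != 0] the forbidden element is [w/z]; for [z = 0], [w] is singular and kills [x] and [x'],
   so [wc + 1] serves. *)
have [z0|z0] := eqVneq z 0; last first.
  apply: (noeig (z^-1 *: w)).
  - by rewrite formZl iw mulr0.
  - by rewrite !formE ww; field.
  - by rewrite mulZl wx scalerK.
  - by rewrite mulZl wx' z'E scalerK.
have [|c wc cU] := dual <<[:: one; x'; x]>>%VS w.
  apply: contra wN => /span3P[r [s [t wE]]].
  have : '[w, one] = 0 := iw; rewrite wE !formE ix ix' !mulr0 !addr0 mulr1 => ->.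
  by rewrite scale0r add0r memvD ?memvZ.
have cX u : u \in [:: one; x'; x] -> '[u, c] = 0.
  by move=> uX; rewrite cU ?memv_span.
have c0 : im c by rewrite formC cX ?mem_head.
have [|e0 ee _ eb] := null_involution w c iw c0 _ wc.
  by rewrite ww z0 expr2 mulr0 oppr0.
apply: (noeig _ e0 ee); apply: eb => //.
- by rewrite wx z0 scale0r.
- by apply: cX; rewrite !inE eqxx ?orbT.
- by rewrite wx' z'E z0 scale0r.
- by apply: cX; rewrite !inE eqxx ?orbT.
Qed.

(** * Blocks: planes in a single block, covering, uniqueness *)

Lemma block_generators W : cd_block A W -> exists P : {vspace 'rV[F]_d},
  [/\ (P <= cd_im A)%VS, \dim P = 2%N &
      forall W', cd_block A W' -> (P <= W')%VS -> W' = W].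
Proof.
move=> [H [sH dH ->]]; have [a [b [aW bW fab]]] := subalg_generators H sH dH.
have [[aH aV] [bH bV]] := (memv_capP aW, memv_capP bW).
exists <<[:: a; b]>>%VS; split.
- by apply/span_subvP => x; rewrite !inE => /orP[]/eqP->.
- move: fab; rewrite !free_cons => /and3P[_ _ ?].
  by rewrite dim_span_free ?free_cons.
move=> _ [H' [sH' dH' ->]] /span_subvP abW'.
have /memv_capP[aH' _] : a \in cd_imsub A H' by apply: abW'; rewrite mem_head.
have /memv_capP[bH' _] : b \in cd_imsub A H' by apply: abW'; rewrite !inE eqxx orbT.
by rewrite (subalg_generated a b H H').
Qed.

Lemma block_cover (P : {vspace 'rV[F]_d}) : (P <= cd_im A)%VS -> \dim P = 2%N ->
  exists2 W, cd_block A W & (P <= W)%VS.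
Proof.
move=> /subvP PV /dim2_basis[a [b [fab aP bP ->]]].
have [H [sH dH aH bH]] :=
  pair_subalg a b (mem_im a (PV a aP)) (mem_im b (PV b bP)) fab.
exists (cd_imsub A H); first by exists H.
by apply/span_subvP => x; rewrite !inE => /orP[]/eqP->; rewrite memv_cap ?aH ?bH PV.
Qed.

Lemma division_block_unique (P W W' : {vspace 'rV[F]_d}) : cd_division A ->
  (P <= cd_im A)%VS -> \dim P = 2%N -> cd_block A W -> cd_block A W' ->
  (P <= W)%VS -> (P <= W')%VS -> W = W'.
Proof.
move=> divA /subvP PV /dim2_basis[a [b [fab aP bP _]]] [H [sH dH ->]].
move=> [H' [sH' dH' ->]] /subvP PW /subvP PW'.
have [a0 b0] := (mem_im a (PV a aP), mem_im b (PV b bP)).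
have [[/memv_capP[aH _] /memv_capP[bH _]]] := (PW a aP, PW b bP).
have [/memv_capP[aH' _] /memv_capP[bH' _]] := (PW' a aP, PW' b bP).
rewrite (subalg_generated a b H H') // free_cons free_one_cons ?andbT //; last first.
  by move=> x; rewrite !inE => /orP[]/eqP->.
(* Were [ab] in [<1, a, b>], then [(a - z)(b - y) = 0] and one factor would vanish, against
   independence of [1], [a], [b]. *)
apply/negP => /(dependent_mul a b a0 b0 fab)[y [z [_ _ _ _ /divA[]]]] /eqP.
  rewrite subr_eq0 => /eqP aE.
  have [|_ /eqP + _] := free3_coef a b z (-1) 0 a0 b0 fab.
    by rewrite scale0r addr0 scaleN1r -aE subrr.
  by rewrite oppr_eq0 oner_eq0.
rewrite subr_eq0 => /eqP bE.
have [|_ _ /eqP] := free3_coef a b y 0 (-1) a0 b0 fab.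
  by rewrite scale0r addr0 scaleN1r -bE subrr.
by rewrite oppr_eq0 oner_eq0.
Qed.

(** * Zero divisors and kernels of left multiplications *)

Lemma dim_rV : \dim {:'rV[F]_d} = d.
Proof. by rewrite dimvf /dim /= mul1n. Qed.

Lemma dim_im : (\dim (cd_im A)).+1 = d.
Proof.
have := dim_imsub fullv (memvf _); rewrite /cd_imsub (capv_idPr (subvf _)) => ->.
exact: dim_rV.
Qed.

(** The imaginary space is a hyperplane, so it meets a kernel of dimension at least 3 in dimension
    at least 2, more than a line. *)
Lemma ker_meets_im u (w : 'rV[F]_d) : (2 < \dim (lker (linfun (cdmul A u))))%N ->
  exists v, [/\ im v, u ** v = 0 & v \notin <[w]>%VS].
Proof.
set K := lker _ => dK.
have [|v /memv_capP[vK vV] vNw] := dim_lt_ex <[w]>%VS (K :&: cd_im A)%VS.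
  rewrite dim_vline; apply: leq_ltn_trans (leq_b1 _) _.
  have leD : (\dim (K + cd_im A) <= (\dim (cd_im A)).+1)%N.
    by rewrite dim_im -[leqRHS]dim_rV dimvS ?subvf.
  rewrite -(ltn_add2l (\dim (K + cd_im A))) dimv_sum_cap addn1.
  by apply: leq_trans (_ : 3 + \dim (cd_im A) <= _)%N; rewrite ?leq_add2r ?ltnS.
exists v; split=> //; first exact: mem_im.
by move: vK; rewrite memv_ker lfunE => /eqP.
Qed.

(** Rank-nullity: the image of multiplication by [u'] lies in the kernel of multiplication by
    [u]. *)
Lemma ker_dim u u' : (forall z, u ** (u' ** z) = 0) ->
  (d <= \dim (lker (linfun (cdmul A u))) + \dim (lker (linfun (cdmul A u'))))%N.
Proof.
move=> uu'; rewrite -[leqLHS]dim_rV.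
rewrite -(limg_ker_dim (linfun (cdmul A u')) fullv) addnC.
rewrite leq_add ?dimvS ?capvSr //; apply/subvP => _ /memv_imgP[z _ ->].
by rewrite memv_ker !lfunE /= uu'.
Qed.

Lemma zero_divisor_null u v : (4 < d)%N -> u != 0 -> v != 0 -> u ** v = 0 ->
  exists a, [/\ im a, a != 0 & '[a, a] = 0].
Proof.
move=> d4 u0 v0 uv.
have [r [w [w0 uE]]] : exists r w, im w /\ u = r *: one + w.
  exists '[u, one], (u - '[u, one] *: one).
  by rewrite !formE mulr1 subrr addrC subrK.
(* The conjugate and the norm of [u]. From [u'(uv) = nv] and [uv = 0] follows [n = 0], so [ker_dim]
   makes one of the two kernels larger than 2. *)
pose u' := r *: one - w; pose n := r ^+ 2 + '[w, w].
have uu' z : u ** (u' ** z) = n *: z.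
  rewrite uE /u' !mulE sqr_l //; apply/rowP => i; rewrite !mxE /n; ring.
have u'u z : u' ** (u ** z) = n *: z.
  rewrite uE /u' !mulE sqr_l //; apply/rowP => i; rewrite !mxE /n; ring.
have n0 : n = 0.
  have := u'u v; rewrite uv cf_mulx0 => /esym/eqP.
  by rewrite scaler_eq0 (negPf v0) orbF => /eqP.
have u'0 : u' != 0.
  apply: contra u0; rewrite subr_eq0 => /eqP rw.
  have r0 : r = 0 by rewrite -w0 -rw !formE mulr1.
  by rewrite uE -rw r0 scale0r addr0.
have null x : x != 0 -> (2 < \dim (lker (linfun (cdmul A x))))%N ->
    exists a, [/\ im a, a != 0 & '[a, a] = 0].
  move=> x0 /(ker_meets_im x 0)[a [a0 xa aN0]]; exists a; split=> //.
    by apply: contraNneq aN0 => ->; rewrite mem0v.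
  (* [0 = (xa)a = -<a, a>x] with [x != 0]. *)
  have := sqr_r a x a0; rewrite xa cf_mul0x => /esym/eqP.
  by rewrite scaler_eq0 oppr_eq0 (negPf x0) orbF => /eqP.
have [/(null u u0) //|leu] := ltnP 2 (\dim (lker (linfun (cdmul A u)))).
apply: (null u' u'0); have := ker_dim u u' (fun z => etrans (uu' z) _).
rewrite n0 => /(_ (fun z => scale0r z)) led.
by rewrite -(ltn_add2l 2); apply: leq_trans d4 (leq_trans led _); rewrite leq_add2r.
Qed.

(** Left multiplication by [a] squares to zero, so its kernel has at least half the dimension, hence
    at least 3. *)
Lemma null_annihilator a : (4 < d)%N -> im a -> '[a, a] = 0 -> a != 0 ->
  exists b, [/\ im b, a ** b = 0 & free [:: b; a]].
Proof.
move=> d4 a0 aa an0.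
have led := ker_dim a a; have {}led := leq_trans d4 (led _).
have [|b [b0 ab bNa]] := ker_meets_im a a.
  rewrite ltnNge; apply/negP => le2; have := leq_add le2 le2.
  rewrite leqNgt (led _) // => z; by rewrite sqr_l // aa oppr0 scale0r.
by exists b; split=> //; rewrite free_cons span_seq1 bNa seq1_free.
Qed.

Lemma block_unique_division : (4 < d)%N ->
  (forall P : {vspace 'rV[F]_d}, (P <= cd_im A)%VS -> \dim P = 2%N ->
     exists W, [/\ cd_block A W, (P <= W)%VS &
       forall W', cd_block A W' -> (P <= W')%VS -> W' = W]) ->
  cd_division A.
Proof.
move=> d4 uniqP u v uv.
have [|u0] := eqVneq u 0; first by left.
have [|v0] := eqVneq v 0; [by right | exfalso].
have [a [a0 an0 aa]] := zero_divisor_null u v d4 u0 v0 uv.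
have [b [b0 ab fba]] := null_annihilator a d4 a0 aa an0.
have fab : free [:: a; b].
  by rewrite (perm_free (Y := [:: b; a])) // (perm_catC [:: a] [:: b]).
have bn0 : b != 0.
  by apply: contraTneq fba => ->; rewrite free_cons mem0v.
have [e [e0 ee eb sH1 fH1]] := null_pair_subalg a b a0 b0 fab ab aa.
have [f [f0 bf sH2 fH2]] := eigen_subalg e b e0 ee b0 eb bn0.
have [eb0 bb] := eigen_form e b e0 b0 eb.
have [||W [_ _ uniqW]] := uniqP <<[:: e; b]>>%VS.
- by apply/span_subvP => x; rewrite !inE => /orP[]/eqP->; rewrite imE ?e0 ?b0.
- rewrite dim_span_free // free_cons seq1_free bn0 andbT.
  rewrite (notin_span e) ?ee ?oppr_eq0 ?oner_eq0 // => x.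
  by rewrite inE => /eqP->; rewrite formC.
have blockW X : cd_subalg A <<X>> -> free X -> size X = 4%N -> e \in X -> b \in X ->
    cd_imsub A <<X>> = W.
  move=> sX fX szX eX bX; apply: uniqW.
    by exists <<X>>%VS; split=> //; rewrite dim_span_free.
  apply/span_subvP => x; rewrite !inE => /orP[]/eqP->;
  by rewrite memv_cap memv_span //= imE ?e0 ?b0.
have : f \in cd_imsub A <<[:: f; one; e; b]>>.
  by rewrite memv_cap memv_span ?mem_head //= imE f0.
rewrite blockW ?inE ?eqxx ?orbT // -(blockW [:: e; one; a; b]) ?inE ?eqxx ?orbT //.
rewrite memv_cap => /andP[fH _].
(* Uniqueness of the block put [f] into [<e, 1, a, b>], all of which is orthogonal to [b], whereas
   [<b, f> = 1]. *)
have /eqP : '[f, b] = 0.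
  apply: form_span0 fH => x; rewrite !inE => /or4P[]/eqP-> //.
  - by rewrite formC.
  - by apply: oppr_inj; rewrite -cf_form_mul1 // ab cf_form0l oppr0.
by rewrite formC bf oner_eq0.
Qed.

End CompositionAlgebra.

(** * The doubling process on pairs *)

Section Doubling.
Variables (F : fieldType) (d : nat) (A : CD F d) (g : F).

Lemma CD_double_mul (a b c e : 'rV[F]_d) :
  cdmul (CD_double A g) (row_mx a b) (row_mx c e) =
  row_mx (cdmul A a c + g *: cdmul A e (cd_conj A b))
         (cdmul A (cd_conj A a) e + cdmul A c b).
Proof. by rewrite /= !row_mxKl !row_mxKr. Qed.

Lemma CD_double_conj (a b : 'rV[F]_d) :
  cd_conj (CD_double A g) (row_mx a b) = row_mx (cd_conj A a) (- b).
Proof.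
by rewrite /cd_conj /= mul_row_block !mulmx0 addr0 add0r mul_mx_scalar scaleN1r.
Qed.
End Doubling.

Lemma CD_base_mul (F : fieldType) (a b : F) :
  cdmul (CD_base F) a%:M b%:M = (a * b)%:M.
Proof. by rewrite /= !mxE !mulr1n. Qed.

Lemma CD_base_conj (F : fieldType) (a : F) : cd_conj (CD_base F) a%:M = a%:M.
Proof. by rewrite /cd_conj /= mul_mx_scalar scale1r. Qed.

Lemma scalar_mxN (F : fieldType) (a : F) : - a%:M = (- a)%:M :> 'M_1.
Proof. by rewrite raddfN. Qed.

Lemma scalar_mxD (F : fieldType) (a b : F) : a%:M + b%:M = (a + b)%:M :> 'M_1.
Proof. by rewrite raddfD. Qed.

(** * Cayley algebras in eight coordinates *)

Section CayleyAlgebra.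
Variables (F : fieldType) (al be ga : F).
Local Notation O := (Cayley al be ga).
Local Notation octo := 'rV[F]_cdim8.

Definition mk4 (a b c d : F) : 'rV[F]_(1 + 1 + (1 + 1)) :=
  row_mx (row_mx a%:M b%:M) (row_mx c%:M d%:M).

Lemma quaternion_conj a b c d :
  cd_conj (CD_double (CD_double (CD_base F) al) be) (mk4 a b c d) =
  mk4 a (- b) (- c) (- d).
Proof. by rewrite /mk4 !CD_double_conj CD_base_conj opp_row_mx !raddfN. Qed.

Lemma quaternion_mul a b c d a' b' c' d' :
  cdmul (CD_double (CD_double (CD_base F) al) be)
    (mk4 a b c d) (mk4 a' b' c' d') =
  mk4 (a * a' + al * b * b' + be * c * c' - al * be * d * d')
      (a * b' + b * a' + be * c * d' - be * d * c')
      (a * c' - al * b * d' + c * a' + al * d * b')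
      (a * d' - b * c' + c * b' + d * a').
Proof.
rewrite /mk4 CD_double_mul !CD_double_conj !CD_base_conj !scalar_mxN.
rewrite !CD_double_mul !CD_base_conj !CD_base_mul.
rewrite !(scale_row_mx, add_row_mx, scale_scalar_mx, scalar_mxD).
by congr (row_mx (row_mx _%:M _%:M) (row_mx _%:M _%:M)); ring.
Qed.

Definition mk8 (a b c d e f g h : F) : octo :=
  row_mx (mk4 a b c d) (mk4 e f g h).

Lemma mk8P (x : octo) : exists a b c d e f g h, x = mk8 a b c d e f g h.
Proof.
have e1 (y : 'rV[F]_1) : y = (y 0 0)%:M by rewrite [LHS]mx11_scalar.
have e2 (n : nat) (y : 'rV[F]_(n + n)) : y = row_mx (lsubmx y) (rsubmx y).
  by rewrite hsubmxK.
rewrite [x](e2 4%N) [lsubmx x](e2 2%N) [rsubmx x](e2 2%N).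
rewrite [lsubmx (lsubmx x)](e2 1%N) [lsubmx (rsubmx x)](e2 1%N).
rewrite [rsubmx (lsubmx x)](e2 1%N) [rsubmx (rsubmx x)](e2 1%N).
by do 8!eexists; rewrite /mk8 /mk4; do 3!f_equal; exact: e1.
Qed.

Lemma mk8D a b c d e f g h a' b' c' d' e' f' g' h' :
  mk8 a b c d e f g h + mk8 a' b' c' d' e' f' g' h' =
  mk8 (a + a') (b + b') (c + c') (d + d') (e + e') (f + f') (g + g') (h + h').
Proof. by rewrite /mk8 /mk4 !add_row_mx -!raddfD. Qed.

Lemma mk8Z s a b c d e f g h :
  s *: mk8 a b c d e f g h =
  mk8 (s * a) (s * b) (s * c) (s * d) (s * e) (s * f) (s * g) (s * h).
Proof. by rewrite /mk8 /mk4 !scale_row_mx !scale_scalar_mx. Qed.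

Lemma mk8_one : cdone O = mk8 1 0 0 0 0 0 0 0.
Proof. by rewrite /mk8 /mk4 !(raddf0, row_mx0). Qed.

Lemma mk8_conj a b c d e f g h :
  cd_conj O (mk8 a b c d e f g h) =
  mk8 a (- b) (- c) (- d) (- e) (- f) (- g) (- h).
Proof.
by rewrite /mk8 /mk4 /Cayley !CD_double_conj CD_base_conj !opp_row_mx !raddfN.
Qed.

(** The full multiplication table turns each identity in [O] into polynomial identities for
    [ring]. *)
Lemma mk8M a b c d e f g h a' b' c' d' e' f' g' h' :
  cdmul O (mk8 a b c d e f g h) (mk8 a' b' c' d' e' f' g' h') =
  mk8
    (a * a' + al * b * b' + be * c * c' - be * al * d * d' + ga * e * e'
      - ga * al * f * f' - ga * be * g * g' + ga * be * al * h * h')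
    (a * b' + b * a' + be * c * d' - be * d * c' + ga * e * f'
      - ga * f * e' + ga * be * g * h' - ga * be * h * g')
    (a * c' - al * b * d' + c * a' + al * d * b' + ga * e * g'
      - ga * al * f * h' - ga * g * e' + ga * al * h * f')
    (a * d' - b * c' + c * b' + d * a' + ga * e * h' - ga * f * g'
      + ga * g * f' - ga * h * e')
    (a * e' - al * b * f' - be * c * g' + be * al * d * h' + e * a'
      + al * f * b' + be * g * c' - be * al * h * d')
    (a * f' - b * e' - be * c * h' + be * d * g' + e * b' + f * a'
      - be * g * d' + be * h * c')
    (a * g' + al * b * h' - c * e' - al * d * f' + e * c' + al * f * d'
      + g * a' - al * h * b')
    (a * h' + b * g' - c * f' - d * e' + e * d' + f * c' - g * b' + h * a').
Proof.
rewrite /Cayley /mk8 CD_double_mul !quaternion_conj !quaternion_mul /mk4.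
rewrite !(scale_row_mx, add_row_mx, scale_scalar_mx, scalar_mxD).
by congr (row_mx (row_mx (row_mx _%:M _%:M) (row_mx _%:M _%:M))
  (row_mx (row_mx _%:M _%:M) (row_mx _%:M _%:M))); ring.
Qed.

Local Notation "x ** y" := (cdmul O x y) (at level 40, left associativity).
Local Notation one := (cdone O).

(** The type ascriptions unfold [cdim8] into the nested sums that [lsubmx] splits. *)
Definition cd_re (x : octo) : F :=
  lsubmx (lsubmx (lsubmx (x : 'rV_(4 + 4)) : 'rV_(2 + 2)) : 'rV_(1 + 1)) 0 0.

Lemma mk8_re a b c d e f g h : cd_re (mk8 a b c d e f g h) = a.
Proof. by rewrite /cd_re /mk8 /mk4 !row_mxKl mxE mulr1n. Qed.

Definition cd_form (x y : octo) : F := cd_re (x ** cd_conj O y).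
Local Notation "'[ x , y ]" := (cd_form x y).

Lemma mk8_form a b c d e f g h a' b' c' d' e' f' g' h' :
  '[mk8 a b c d e f g h, mk8 a' b' c' d' e' f' g' h'] =
  a * a' - al * b * b' - be * c * c' + al * be * d * d' - ga * e * e'
  + al * ga * f * f' + be * ga * g * g' - al * be * ga * h * h'.
Proof. by rewrite /cd_form mk8_conj mk8M mk8_re; ring. Qed.

Definition mk8E := (mk8_form, mk8_one, mk8M, mk8D, mk8Z, mk8_re).

Ltac coord x :=
  have [? [? [? [? [? [? [? [? ->]]]]]]]] := mk8P x.
Ltac coord_ring := rewrite ?mk8E; try (congr mk8); ring.

Lemma cd_mulDl x y z : (x + y) ** z = x ** z + y ** z.
Proof. by coord x; coord y; coord z; coord_ring. Qed.

Lemma cd_mulDr x y z : x ** (y + z) = x ** y + x ** z.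
Proof. by coord x; coord y; coord z; coord_ring. Qed.

Lemma cd_mulZl s x y : (s *: x) ** y = s *: (x ** y).
Proof. by coord x; coord y; coord_ring. Qed.

Lemma cd_mulZr s x y : x ** (s *: y) = s *: (x ** y).
Proof. by coord x; coord y; coord_ring. Qed.

Lemma cd_mul1x x : one ** x = x.
Proof. by coord x; coord_ring. Qed.

Lemma cd_mulx1 x : x ** one = x.
Proof. by coord x; coord_ring. Qed.

Lemma cd_formC x y : '[x, y] = '[y, x].
Proof. by coord x; coord y; coord_ring. Qed.

Lemma cd_formDl x y z : '[x + y, z] = '[x, z] + '[y, z].
Proof. by coord x; coord y; coord z; coord_ring. Qed.

Lemma cd_formZl s x y : '[s *: x, y] = s * '[x, y].
Proof. by coord x; coord y; coord_ring. Qed.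

Lemma cd_reE x : cd_re x = '[x, one].
Proof. by coord x; coord_ring. Qed.

Lemma cd_form11 : '[one, one] = 1.
Proof. by coord_ring. Qed.

(** The hypothesis says that the first coordinate of [a] is zero; substituting this leaves a
    polynomial identity. *)
Lemma cd_form_mull a x y : '[a, one] = 0 -> '[a ** x, y] = - '[x, a ** y].
Proof.
by rewrite -!cd_reE; coord a; coord x; coord y; rewrite !mk8_re => ->; coord_ring.
Qed.

Lemma cd_mul_sqr_l a z : '[a, one] = 0 -> a ** (a ** z) = - '[a, a] *: z.
Proof.
by rewrite -!cd_reE; coord a; coord z; rewrite !mk8_re => ->; coord_ring.
Qed.

Lemma cd_mul_sqr_r a z : '[a, one] = 0 -> (z ** a) ** a = - '[a, a] *: z.
Proof.
by rewrite -!cd_reE; coord a; coord z; rewrite !mk8_re => ->; coord_ring.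
Qed.

Hypothesis two_neq0 : 2%:R != 0 :> F.

Lemma cd_imE x : (x \in cd_im O) = ('[x, one] == 0).
Proof.
rewrite memv_ker.
(* The bare function in [cd_im] is recast as [mulmxr], which is known to be linear, so that [lfunE]
   applies. *)
have -> : linfun (fun y : octo => y *m (cdconj O + 1%:M)) =
          linfun (mulmxr (cdconj O + 1%:M)) by [].
rewrite lfunE /= mulmxDr mulmx1 -/(cd_conj O x) -cd_reE.
coord x; rewrite mk8_conj mk8D mk8_re !addNr -[_ + _]mulr2n -mulr_natl.
apply/eqP/eqP => [/(congr1 cd_re)|->].
  rewrite mk8_re => /eqP.
  have -> : (0 : octo) = mk8 0 0 0 0 0 0 0 0.
    by rewrite /mk8 /mk4 !(raddf0, row_mx0).
  by rewrite mk8_re mulf_eq0 (negPf two_neq0) => /eqP.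
by rewrite mulr0 /mk8 /mk4 !(raddf0, row_mx0).
Qed.

(** * Nondegeneracy of the form *)

Hypotheses (al_neq0 : al != 0) (be_neq0 : be != 0) (ga_neq0 : ga != 0).

Lemma cd_riesz (phi : octo -> F) :
  (forall s u v, phi (s *: u + v) = s * phi u + phi v) ->
  exists c, forall z, '[z, c] = phi z.
Proof.
move=> phiL.
have phi0 : phi 0 = 0.
  have /eqP := phiL 1 0 0.
  by rewrite scaler0 addr0 mul1r -subr_eq subrr eq_sym => /eqP.
(* The basis is orthogonal, so each coordinate is the value of [phi] on a basis vector divided by
   its norm. *)
exists (mk8 (phi (mk8 1 0 0 0 0 0 0 0)) (- phi (mk8 0 1 0 0 0 0 0 0) / al)
  (- phi (mk8 0 0 1 0 0 0 0 0) / be) (phi (mk8 0 0 0 1 0 0 0 0) / (al * be))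
  (- phi (mk8 0 0 0 0 1 0 0 0) / ga) (phi (mk8 0 0 0 0 0 1 0 0) / (al * ga))
  (phi (mk8 0 0 0 0 0 0 1 0) / (be * ga))
  (- phi (mk8 0 0 0 0 0 0 0 1) / (al * be * ga))) => z.
have [a [b [c [d [e [f [g [h ->]]]]]]]] := mk8P z.
(* The trailing [+ 0] gives every term the shape [s *: u + v] required by [phiL]. *)
have zE : mk8 a b c d e f g h =
  a *: mk8 1 0 0 0 0 0 0 0 + (b *: mk8 0 1 0 0 0 0 0 0 +
  (c *: mk8 0 0 1 0 0 0 0 0 + (d *: mk8 0 0 0 1 0 0 0 0 +
  (e *: mk8 0 0 0 0 1 0 0 0 + (f *: mk8 0 0 0 0 0 1 0 0 +
  (g *: mk8 0 0 0 0 0 0 1 0 + (h *: mk8 0 0 0 0 0 0 0 1 + 0))))))).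
  by rewrite addr0; coord_ring.
rewrite [in RHS]zE !phiL phi0 mk8_form.
by field; rewrite al_neq0 be_neq0 ga_neq0.
Qed.

(** Some coordinate of [z - projv U z] is nonzero at [z = x]; scaled to 1 there, it is a linear
    functional vanishing on [U], represented by [cd_riesz]. *)
Lemma cd_form_dual (U : {vspace octo}) x : x \notin U ->
  exists2 c, '[x, c] = 1 & {in U, forall u, '[u, c] = 0}.
Proof.
move=> xNU; pose p z := z - projv U z.
have [i pxi|px0] := pickP (fun i => p x 0 i != 0); last first.
  case/negP: xNU; rewrite -[x](subrK (projv U x)) -/(p x).
  have -> : p x = 0.
    apply/rowP => i; rewrite [RHS]mxE; apply/eqP.
    by have /negbT := px0 i; rewrite negbK.
  by rewrite add0r memv_proj.
have [|c cE] := cd_riesz (fun z => p z 0 i / p x 0 i).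
  move=> s u v; rewrite mulrA -mulrDl; congr (_ / _).
  by rewrite /p linearP /= !mxE; ring.
exists c => [|u uU]; rewrite cE ?divff //.
by rewrite /p projv_id // subrr mxE mul0r.
Qed.

Lemma Cayley_composition_form : composition_form F cdim8 O cd_form.
Proof.
split.
- exact: cd_mulDl.
- exact: cd_mulDr.
- exact: cd_mulZl.
- exact: cd_mulZr.
- exact: cd_mul1x.
- exact: cd_mulx1.
- exact: cd_formC.
- exact: cd_formDl.
- exact: cd_formZl.
- exact: cd_form11.
- exact: cd_imE.
- exact: cd_mul_sqr_l.
- exact: cd_mul_sqr_r.
- exact: cd_form_mull.
- exact: cd_form_dual.
Qed.

End CayleyAlgebra.

Theorem mainTheorem2 (F : fieldType) (al be ga : F) :
  (2%:R : F) != 0 -> al != 0 -> be != 0 -> ga != 0 ->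
  let O := Cayley al be ga in
  let V := cd_im O in
  (* (V, B) is a (7,3,2) q-covering design *)
  [/\ \dim V = 7%N,
      (forall W, cd_block O W -> (W <= V)%VS /\ \dim W = 3%N),
      (forall P : {vspace 'rV[F]_cdim8}, (P <= V)%VS -> \dim P = 2%N ->
         exists2 W, cd_block O W & (P <= W)%VS),
      (* inclusion-minimality: every subcollection that covers is all of B *)
      (forall C : {vspace 'rV[F]_cdim8} -> Prop,
         (forall W, C W -> cd_block O W) ->
         (forall P : {vspace 'rV[F]_cdim8}, (P <= V)%VS -> \dim P = 2%N ->
            exists2 W, C W & (P <= W)%VS) ->
         forall W, cd_block O W -> C W)
    & (* 2-(7,3,1) subspace design iff O is a division algebra *)
      ((forall P : {vspace 'rV[F]_cdim8}, (P <= V)%VS -> \dim P = 2%N ->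
          exists W, [/\ cd_block O W, (P <= W)%VS &
                        forall W', cd_block O W' -> (P <= W')%VS -> W' = W])
       <-> cd_division O)].
Proof.
move=> two al0 be0 ga0 O V; rewrite {}/V.
have formO := Cayley_composition_form F al be ga two al0 be0 ga0.
rewrite -/O in formO.
have cover := block_cover F cdim8 O _ formO two.
split=> //.
- by apply: succn_inj; rewrite (dim_im F cdim8 O _ formO).
- move=> _ [H [[oH _] dH ->]]; split; first exact: capvSr.
  by apply: succn_inj; rewrite (dim_imsub F cdim8 O _ formO).
- move=> C Cblock Ccover W bW.
  (* [W] is the only block containing [P], so the member of [C] that covers [P] must be [W]. *)
  have [P [PV dP uniqP]] := block_generators F cdim8 O _ formO two W bW.
  by have [W' CW' PW'] := Ccover P PV dP; rewrite -(uniqP W' (Cblock W' CW') PW').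
split=> [|divO P PV dP]; first exact: (block_unique_division F cdim8 O _ formO two).
have [W bW PW] := cover P PV dP; exists W; split=> // W' bW' PW'.
exact: (division_block_unique F cdim8 O _ formO P).
Qed.
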